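(* Let $2\le d\le n$ and let $X^n\subset\mathbb P^{n+1}$ be a hypersurface of degree at least $d$ with nondegenerate Gauss map. Let $U\subset X$ be an open subset consisting of $d$-general points and admitting a coordinate framing $e$ (as described in the context), and consider the map $$\tilde\phi_{d,e}:U\to\bigoplus_{\delta=2}^dS^\delta T^*,\qquad x\mapsto\left(F_{2,e}(x),\dots,F_{d,e}(x)\right).$$ Assume further that $\gamma_{\tilde\phi_{d,e}}$ is defined on $U$, that is, $\mathrm{rank}(d\tilde\phi_{d,e}|_x)=n$ for all $x\in U$. Then: (a) The Gauss image $\gamma_{\tilde\phi_{d,e}}(U)$ is contained in $\mathbf\Xi_d$. (b) If $\deg(X)=d$, then $\gamma_{\tilde\phi_{d,e}}(U)\subset\mathbf\Phi_d$.
   Context: Everything is over $\mathbb C$. $V=\mathbb C^{n+2}$, $N=n+1$, $X^n\subset\mathbb P V=\mathbb P^{n+1}$; $\hat x\subset V$ is the line of $x$, $\widehat T_xX\subset V$ is the affine tangent space, $T_xX=\hat x^*\otimes(\widehat T_xX/\hat x)$, $N_xX=\hat x^*\otimes(V/\widehat T_xX)$. The Gauss map $x\mapsto\widehat T_xX\in G(n+1,V)$ is nondegenerate if its differential has maximal rank $n$ (at general points). A point $x\in X$ is $d$-general if all discrete projective differential invariants up to order $d$ are constant on a Zariski open subset of $X$ containing $x$. Coordinate framing. Near a smooth point choose homogeneous coordinates $[z_0:\dots:z_N]$ such that the point is $[1:0:\dots:0]$ and $\widehat X$ is tangent to $\{z_N=0\}$ there. In the affine chart $z_0=1$, $X$ is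 locally a graph $z^N=f(z^1,\dots,z^n)$ over an open set; $z=(z^1,\dots,z^n)$ are local coordinates on $X$. The framing $e=(e_0,\dots,e_N)$ (bases of $V$ depending on $z$) is $$e_0=\partial_{z^0}+z^a\partial_{z^a}+f\,\partial_{z^N},\quad e_a=\partial_{z^a}+f_{z^a}\partial_{z^N}\ (1\le a\le n),\quad e_N=\partial_{z^N},$$ where subscripts on $f$ denote partial derivatives and repeated indices are summed from $1$ to $n$. With $(e^j)$ the dual basis, $\underline e_a=e^0\otimes(e_a\bmod e_0)$ is a basis of $T_zX$ and $\underline e_N=e^0\otimes(e_N\bmod\widehat T_zX)$ spans $N_zX$. In this framing the Fubini forms are $$F_{k,e}(z)=(-1)^kf_{z^{a_1}\cdots z^{a_k}}(z)\,dz^{a_1}\cdots dz^{a_k}\otimes\underline e_N,\qquad k\ge2.$$ Fix a complex vector space $T$ of dimension $n$; the frame identifies every $T_zX$ with $T$ (the $dz^a$ being the basis dual to $\underline e_a$) and $N_zX$ with $\mathbb C$, so that $F_{k,e}(z)\in S^kT^*$. Gauss map of a map. If $f:Z\to\Sigma$ is a $C^1$ map of manifolds of generic rank $r$, $\gamma_f$ is defined at points $z$ with $\mathrm{rank}(df_z)=r$ by $\gamma_f(z)=T_{f(z)}f(Z)=df_z(T_zZ)$, in the Grassmann bundle $\mathbf G(r,T\Sigma)$. Bundles. For $v\in T$, $v\lrcorner:S^\delta T^*\to S^{\delta-1}T^*$ is the interior product $(v\lrcorner P)(w_1,\dots,w_{\delta-1})=P(v,w_1,\dots,w_{\delta-1})$.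 For $\mathbf P=(P_2,\dots,P_d)\in\bigoplus_{\delta=2}^dS^\delta T^*$ and $\alpha\in S^{d+1}T^*$ set $$E_{\mathbf P,\alpha}=\{(v\lrcorner P_3,\dots,v\lrcorner P_d,v\lrcorner\alpha):v\in T\}\subset\bigoplus_{\delta=2}^dS^\delta T^*.$$ Let $\mathbf\Xi_{\mathbf P}\subset G(n,\bigoplus_{\delta=2}^dS^\delta T^* )$ be the set of those $E_{\mathbf P,\alpha}$, $\alpha\in S^{d+1}T^*$, which have dimension $n$, and let $\mathbf\Phi_{\mathbf P}\subset\mathbf\Xi_{\mathbf P}$ be the set of those with $\alpha\in I_{d+1}(\mathbf P)$, where $I_{d+1}(\mathbf P)$ is the degree $d+1$ component of the ideal generated by $P_2,\dots,P_d$. Identifying the tangent space of the vector space $\bigoplus_{\delta=2}^dS^\delta T^*$ at $\mathbf P$ with the space itself, $\mathbf\Phi_d\subset\mathbf\Xi_d\subset\mathbf G(n,T(\bigoplus_{\delta=2}^dS^\delta T^* ))$ are the subsets with fibers $(\mathbf\Xi_d)_{\mathbf P}=\mathbf\Xi_{\mathbf P}$ and $(\mathbf\Phi_d)_{\mathbf P}=\mathbf\Phi_{\mathbf P}$. *)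

(* Defs.v *)
From mathcomp Require Import all_boot all_order all_algebra.
From mathcomp Require Import all_classical all_reals all_analysis.
(* The notations of mpoly clash with those of the analysis library. *)
From mathcomp Require Export -(notations) mpoly.
Set Implicit Arguments.
Unset Strict Implicit.
Unset Printing Implicit Defensive.
Import Order.TTheory GRing.Theory Num.Theory numFieldNormedType.Exports.
Local Open Scope classical_set_scope.
Local Open Scope ring_scope.

(* The definitions are stated over any numFieldType C with the topology of its
   norm; the theorem takes C = R[i].  V = C^(n+2) consists of row vectors, and
   subsets of the projective space PV are represented by their cones, i.e. by sets of
   nonzero vectors stable under nonzero scalars. *)

Section Hypersurfaces.
Variables (C : numFieldType) (n : nat).
Local Notation V := 'rV[C]_n.+2.
Local Notation hpoly := (mpoly n.+2 C).

Definition evalp (p : hpoly) (x : V) : C := meval (fun i => x ord0 i) p.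

Definition squarefree (p : hpoly) : Prop :=
  forall q r : hpoly, p = q ^+ 2 * r -> exists c : C, q = mpolyC n.+2 c.

(* Q is a reduced equation of a hypersurface X of degree e. *)
Definition hypersurface (e : nat) (Q : hpoly) : Prop :=
  [/\ Q != 0, Q \is ishomog1 e mdeg & squarefree Q].

Definition on_hypersurface (Q : hpoly) (x : V) : Prop :=
  x != 0 /\ evalp Q x = 0.

Definition grad (Q : hpoly) (x : V) : V := \row_i evalp (mderiv i Q) x.

Definition smooth_point (Q : hpoly) (x : V) : Prop :=
  on_hypersurface Q x /\ grad Q x != 0.

(* The affine tangent space, as a row space: the w with sum_i w_i dQ/dx_i = 0. *)
Definition affine_tangent (Q : hpoly) (x : V) : 'M[C]_n.+2 :=
  kermx (grad Q x)^T.

Definition zariski_open (O : set V) : Prop :=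
  exists H : set hpoly,
    (forall h, H h -> exists k, h \is ishomog1 k mdeg) /\
    O = [set x | x != 0 /\ exists2 h, H h & evalp h x != 0].

Definition zariski_dense_in (Q : hpoly) (O : set V) : Prop :=
  forall O' : set V, zariski_open O' ->
    (exists x, on_hypersurface Q x /\ O' x) ->
    exists x, [/\ on_hypersurface Q x, O' x & O x].

(* A hyperplane of V is identified with the line of linear forms vanishing on
   it, so that G(n+1,V) = PV^* and the Gauss map of X is [x] |-> [grad Q x].
   Its differential at [x] is, up to twisting by lines, the map
   affine_tangent / <x>  ->  V^* / <grad Q x>  induced by the differential of
   grad Q; by Euler's formula x is mapped to 0, so it does not affect the rank. *)
Definition gauss_rank (Q : hpoly) (x : V) : nat :=
  \rank (affine_tangent Q x *m jacobian (grad Q) x *m cokermx (grad Q x)).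

Definition nondegenerate_gauss_map (Q : hpoly) : Prop :=
  exists O : set V, [/\ zariski_open O, zariski_dense_in Q O &
    forall x, on_hypersurface Q x -> O x ->
      smooth_point Q x /\ gauss_rank Q x = n].

(* Equality of the k-jets at x of {Q = 0} and {Q' = 0}: for some u with
   u(x) != 0, Q' - u Q vanishes at x to order > k. *)
Definition same_jet (k : nat) (Q Q' : hpoly) (x : V) : Prop :=
  exists u : hpoly, evalp u x != 0 /\
    forall m : multinom n.+2, (mdeg m <= k)%N ->
      evalp (mderivm m (Q' - u * Q)) x = 0.

(* An integer attached to every smooth point of every hypersurface, invariant
   under GL(V) and depending only on the k-jet. *)
Definition discrete_projective_invariant (k : nat) (I : hpoly -> V -> int) :
    Prop :=
  (forall e Q Q' x (g : 'M[C]_n.+2),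
     hypersurface e Q -> hypersurface e Q' -> smooth_point Q x ->
     g \in unitmx -> (forall y : V, evalp Q' (y *m g) = evalp Q y) ->
     I Q' (x *m g) = I Q x) /\
  (forall e e' Q Q' x,
     hypersurface e Q -> hypersurface e' Q' ->
     smooth_point Q x -> smooth_point Q' x ->
     same_jet k Q Q' x -> I Q' x = I Q x).

(* Inv is the collection of discrete invariants (ranks, dimensions, ...) that
   general points refer to.  It cannot consist of all integer-valued invariant
   functions of the jet, since these separate the orbits of jets and are not
   constant near any point of a hypersurface whose jets vary in moduli; the
   theorem is stated for every Inv. *)
Definition general_point (Inv : set (hpoly -> V -> int)) (Q : hpoly) (x : V) :
    Prop :=
  smooth_point Q x /\
  exists O : set V, [/\ zariski_open O, O x &
    forall y, on_hypersurface Q y -> O y ->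
      smooth_point Q y /\ forall I, Inv I -> I Q y = I Q x].

Definition open_in_hypersurface (Q : hpoly) (U : set V) : Prop :=
  (exists2 W : set V, open W & U = [set x | on_hypersurface Q x /\ W x]) /\
  (forall (c : C) x, c != 0 -> U x -> U (c *: x)).

(* The rows of A are the vectors d/dz^0, ..., d/dz^N of the coordinate system;
   this is the point with coordinates [1 : z^1 : ... : z^n : w]. *)
Definition chart_point (A : 'M[C]_n.+2) (z : 'rV[C]_n) (w : C) : V :=
  row ord0 A + \sum_(a < n) z ord0 a *: row (inord a.+1) A
  + w *: row ord_max A.

(* The vector e_0(z) of the framing. *)
Definition frame0 (A : 'M[C]_n.+2) (f : 'rV[C]_n -> C^o) (z : 'rV[C]_n) : V :=
  chart_point A z (f z).

Record coordinate_framing (Q : hpoly) (A : 'M[C]_n.+2) (D : set 'rV[C]_n)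
    (f : 'rV[C]_n -> C^o) : Prop := CoordinateFraming {
  framing_unit : A \in unitmx ;
  framing_base : smooth_point Q (row ord0 A) ;
  framing_tangent : forall j : 'I_n.+2, j != ord_max ->
    (row j A <= affine_tangent Q (row ord0 A))%MS ;
  framing_open : open D ;
  framing_0 : D 0 /\ f 0 = 0 ;
  framing_holomorphic : forall z, D z -> differentiable f z ;
  framing_graph : exists2 W : set V, open W &
    forall z w, W (chart_point A z w) /\ on_hypersurface Q (chart_point A z w)
      <-> D z /\ w = f z }.

End Hypersurfaces.

(* T = C^n.  A k-linear form on T is given by its components
   P(e_{a_1}, ..., e_{a_k}); S^k T^* consists of the symmetric ones. *)
Section Forms.
Variables (C : numFieldType) (n : nat).
Local Notation T := 'rV[C]_n.

Definition kform (k : nat) : Type := k.-tuple 'I_n -> C.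

Definition symmetric_form k (P : kform k) : Prop :=
  forall s t : k.-tuple 'I_n, perm_eq s t -> P s = P t.

Definition interior k (v : T) (P : kform k.+1) : kform k :=
  fun t => \sum_(a < n) v ord0 a * P [tuple of a :: t].

(* The image of P in the symmetric algebra C[dz^1, ..., dz^n] of T^*. *)
Definition form_poly k (P : kform k) : mpoly n C :=
  \sum_(t : k.-tuple 'I_n) P t *: \prod_(a <- t) mpolyX C (mnm1 a).

(* The family with P in degree k and 0 in the other degrees; the sum has at most
   one term, and the detour through seq avoids a cast between tuple types. *)
Definition in_degree k (P : kform k) (l : nat) : kform l :=
  fun t => \sum_(s : k.-tuple 'I_n | tval s == tval t) P s.
Arguments in_degree {k} P l t.

Variable d : nat.

(* The sum over 2 <= delta <= d of the delta-linear forms on T; the summand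
   delta is indexed by k with delta = k.+2. *)
Definition form_index := {k : 'I_d.-1 & k.+2.-tuple 'I_n}.
Definition forms_sum := 'rV[C]_#|{: form_index}|.

Definition assemble (P : forall k, kform k) : forms_sum :=
  \row_j let i : form_index := enum_val j in P (tag i).+2 (tagged i).

(* The component of P in degree k, which is 0 unless 2 <= k <= d. *)
Definition component (P : forms_sum) (k : nat) : kform k :=
  fun t => \sum_(i : form_index | tval (tagged i) == tval t) P ord0 (enum_rank i).
Arguments component P k t : clear implicits.

Definition in_symmetric_sum (P : forms_sum) : Prop :=
  forall k, symmetric_form (component P k).

(* (v _| P_3, ..., v _| P_d, v _| alpha) *)
Definition E_vector (P : forms_sum) (alpha : kform d.+1) (v : T) : forms_sum :=
  assemble (fun k =>
    interior v (fun t => component P k.+1 t + in_degree alpha k.+1 t)).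

Definition is_E (P : forms_sum) (alpha : kform d.+1) (E : {vspace forms_sum}) :
    Prop :=
  forall w : forms_sum, w \in E <-> exists v : T, w = E_vector P alpha v.

(* alpha lies in the ideal generated by P_2, ..., P_d. *)
Definition in_ideal (P : forms_sum) (alpha : kform d.+1) : Prop :=
  exists c : nat -> mpoly n C,
    form_poly alpha =
    \sum_(2 <= k < d.+1) c k * form_poly (component P k).

(* Points of the Grassmann bundle are pairs (base point, subspace). *)
Definition Xi : set (forms_sum * {vspace forms_sum}) :=
  [set PE | in_symmetric_sum PE.1 /\
    exists alpha, [/\ symmetric_form alpha, is_E PE.1 alpha PE.2 &
                      \dim PE.2 = n]].

Definition Phi : set (forms_sum * {vspace forms_sum}) :=
  [set PE | in_symmetric_sum PE.1 /\
    exists alpha, [/\ symmetric_form alpha, is_E PE.1 alpha PE.2,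
                      \dim PE.2 = n & in_ideal PE.1 alpha]].

Definition partials (f : T -> C^o) (s : seq 'I_n) : T -> C^o :=
  foldr (fun a (g : T -> C^o) z => 'D_(delta_mx ord0 a) g z) f s.

Definition fubini_form (f : T -> C^o) (z : T) (k : nat) : kform k :=
  fun t => (-1) ^+ k * partials f t z.
Arguments fubini_form f z k t : clear implicits.

Definition fubini_map (f : T -> C^o) (z : T) : forms_sum :=
  assemble (fubini_form f z).

End Forms.
Arguments component {C n d} P k t.
Arguments fubini_form {C n} f z k t.
Arguments Xi C n d : clear implicits.
Arguments Phi C n d : clear implicits.

Section GaussMap.
Variables (C : numFieldType) (n m : nat).

Definition diff_image (g : 'rV[C]_n -> 'rV[C]_m) (z : 'rV[C]_n) :
    {vspace 'rV[C]_m} :=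
  limg (linfun ('d g z)).

Definition diff_rank (g : 'rV[C]_n -> 'rV[C]_m) (z : 'rV[C]_n) : nat :=
  \dim (diff_image g z).

Definition gauss_map (g : 'rV[C]_n -> 'rV[C]_m) (z : 'rV[C]_n) :
    'rV[C]_m * {vspace 'rV[C]_m} :=
  (g z, diff_image g z).

End GaussMap.

(* Main.v *)
Require Import Defs.
From mathcomp Require Import all_boot all_order all_algebra.
From mathcomp Require Import complex.
From mathcomp Require Import all_classical all_reals all_analysis.
Set Implicit Arguments.
Unset Strict Implicit.
Unset Printing Implicit Defensive.
Import Order.TTheory GRing.Theory Num.Theory numFieldNormedType.Exports.
Local Open Scope classical_set_scope.
Local Open Scope ring_scope.

(* The partial derivatives of f are obtained from the coordinates, f itself and
   the derivative of Q along the last coordinate vector by ring operations and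
   division, since Q(e_0(z)) = 0 and that derivative vanishes at no smooth point
   of X.  Hence f has derivatives of all orders and they are symmetric, without
   any complex analysis, and (a) is the chain rule with alpha = F_{d+1}.
   For (b), differentiate Q(e_0(z)) = 0 formally d + 1 times.  The result is a
   sum of products of forms F_k; modulo the ideal of F_2, ..., F_d, and because
   Q has only d factors in each monomial, all that is left is F_{d+1} times the
   nonzero derivative of Q, so F_{d+1} lies in the ideal. *)

(** * Differentials, binomial sums and induction on multivariate polynomials *)

(** The differential of [f] at [a] serves for [g] too, because the first-order expansions agree near
    [a]. This handles functions that are known only on an open set. *)
Lemma near_eq_differentiable (R : numFieldType) (V W : normedModType R)
    (f g : V -> W) (a : V) :
  {near a, f =1 g} -> differentiable f a -> differentiable g a.
Proof.
move=> fg df; have df' := df; move: df' => /diff_locallyP[cf ef].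
have eg : g \o shift a = cst (g a) + 'd f a +o_ 0 id.
  apply/eqaddoP => e e0; have /eqaddoP/(_ e e0) := ef.
  have near_fg : \forall h \near (0 : V), f (h + a) = g (h + a).
    by rewrite (near_shift a) sub0r; apply: filterS fg => x /=; rewrite subrK.
  by apply: filterS2 near_fg => h; rewrite !fctE /= => ->; rewrite (nbhs_singleton fg).
have eq_d := diff_unique cf eg.
by apply/diff_locallyP; split; rewrite eq_d.
Qed.

Lemma diff_rV_coord (R : numFieldType) (m : nat) (M : 'rV[R]_m) (j : 'I_m) :
  'd (fun N : 'rV[R]_m => N ord0 j : R^o) M = (fun N => N ord0 j) :> (_ -> _).
Proof.
have @L : {linear 'rV[R]_m -> R^o}.
  by exists (fun N : 'rV[R]_m => N ord0 j); do 2![eexists]; do ?[constructor];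
     rewrite ?mxE// => ? *; rewrite ?mxE//; move=> ?; rewrite !mxE.
by rewrite -[RHS]/(L : _ -> _) -(diff_lin M (_ : continuous L))//;
  exact: coord_continuous.
Qed.

(** Inductive step of Leibniz' formula: [F i j] stands for a product of derivatives of orders [i]
    and [j], and one more derivative falls on either factor. *)
Lemma pascal_sum (R : nmodType) (F : nat -> nat -> R) k :
  \sum_(i < k.+1) (F i.+1 (k - i)%N + F i (k - i).+1) *+ 'C(k, i) =
  \sum_(i < k.+2) F i (k.+1 - i)%N *+ 'C(k.+1, i).
Proof.
under eq_bigr do rewrite mulrnDl.
rewrite big_split /= [RHS]big_ord_recl bin0 subn0.
under [X in _ = _ + X]eq_bigr => i _ do rewrite lift0 subSS binS mulrnDr.
rewrite big_split /= addrA [RHS]addrC; congr (_ + _).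
rewrite [X in _ = _ + X]big_ord_recr /= bin_small// mulr0n addr0.
rewrite big_ord_recl /= bin0 subn0; congr (_ + _); apply: eq_bigr => i _.
by rewrite /bump leq0n add1n subnSK.
Qed.

Lemma mpolyX_ind (N : nat) (R : nzRingType) (P : nat -> mpoly N R -> Prop) :
  P 0%N 1 -> (forall r j p, P r p -> P r.+1 (mpolyX R (mnm1 j) * p)) ->
  forall m, P (mdeg m) (mpolyX R m).
Proof.
move=> P1 PX m; move: {2}(mdeg m) (erefl (mdeg m)) => r.
elim: r m => [|r IH] m dm.
  by move/eqP: (dm); rewrite mdeg_eq0 dm => /eqP ->; rewrite mpolyX0.
have [j mj] : exists j, m j != 0%N.
  apply/existsP; rewrite -[X in is_true X]negbK negb_exists.
  apply/negP => /forallP m0; move: dm; rewrite mdegE big1 // => i _.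
  by apply/eqP; have := m0 i; rewrite negbK.
have def_m : m = mnm_add (mnm1 j) (mnm_sub m (mnm1 j)).
  by rewrite addmC submK// lep1mP.
have dm' : mdeg (mnm_sub m (mnm1 j)) = r.
  by move: dm; rewrite {1}def_m mdegD mdeg1 add1n => -[].
by rewrite dm def_m mpolyXD; apply: PX; rewrite -dm'; apply: IH.
Qed.

(** The index [r] is an upper bound for the degree, not the degree itself. Hence the closure under
    raising [r], which lets monomials of different degrees be added. *)
Lemma mpoly_deg_ind (N : nat) (R : nzRingType) (P : nat -> mpoly N R -> Prop) :
  P 0%N 1 -> (forall r j p, P r p -> P r.+1 (mpolyX R (mnm1 j) * p)) ->
  (forall r, P r 0) -> (forall r s p, (r <= s)%N -> P r p -> P s p) ->
  (forall r c p q, P r p -> P r q -> P r (c *: p + q)) ->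
  forall r p, {in msupp p, forall m, (mdeg m <= r)%N} -> P r p.
Proof.
move=> P1 PX P0 Pw PL r p dp; rewrite [p]mpolyE big_seq.
elim/big_rec: _ => [|m q mp Pq]; first exact: P0.
by apply: PL => //; apply: Pw (dp m mp) _; exact: mpolyX_ind.
Qed.

Lemma mpoly_alg_ind (N : nat) (R : nzRingType) (P : mpoly N R -> Prop) :
  P 0 -> P 1 -> (forall j p, P p -> P (mpolyX R (mnm1 j) * p)) ->
  (forall c p q, P p -> P q -> P (c *: p + q)) -> forall p, P p.
Proof.
move=> P0 P1 PX PL p; rewrite [p]mpolyE; elim/big_rec: _ => [//|m q _ Pq].
by apply: PL => //; apply: (@mpolyX_ind _ _ (fun=> P)) => // _; exact: PX.
Qed.

Lemma mderivXU (N : nat) (R : nzRingType) (i j : 'I_N) :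
  mderiv i (mpolyX R (mnm1 j)) = (i == j)%:R.
Proof.
rewrite mderivX mnm1E eq_sym; case: eqP => [->|_]; last by rewrite scale0r.
rewrite scale1r (_ : mnm_sub _ _ = mnm0) ?mpolyX0//.
by apply/mnmP => k; rewrite mnmBE subnn mnm0E.
Qed.

(** Both sides are linear in [p]; on a monomial, each variable factor contributes one copy of the
    monomial. *)
Lemma euler_dhomog (N : nat) (R : comNzRingType) (e : nat) (p : mpoly N R) :
  p \is ishomog1 e mdeg -> \sum_j mpolyX R (mnm1 j) * mderiv j p = p *+ e.
Proof.
move=> /dhomogP hp.
pose P r (q : mpoly N R) := \sum_j mpolyX R (mnm1 j) * mderiv j q = q *+ r.
have PX m : P (mdeg m) (mpolyX R m).
  apply: mpolyX_ind => [|r j q Pq].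
    by rewrite /P big1 // => j _; rewrite -mpolyC1 mderivC mulr0.
  rewrite /P; under eq_bigr => i _ do rewrite mderivM mulrDr [X in _ + X]mulrCA.
  rewrite big_split /= -mulr_sumr Pq mulrnAr mulrSr addrC; congr (_ + _).
  rewrite (bigD1 j) //= mderivXU eqxx mul1r big1 ?addr0// => i ij.
  by rewrite mderivXU (negbTE ij) mul0r mulr0.
suff : P e p by []; rewrite [p]mpolyE big_seq.
elim/big_rec: _ => [|m q mp Pq]; rewrite /P.
  by rewrite mul0rn big1 // => j _; rewrite mderiv0 mulr0.
under eq_bigr => j _ do rewrite mderivD mderivZ mulrDr -scalerAr.
by rewrite big_split /= -scaler_sumr PX Pq (hp m mp) mulrnDl scalerMnr.
Qed.

(** * Partial derivatives and rings of smooth functions *)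

Section Partial.
Variables (C : numFieldType) (n : nat).
Local Notation T := 'rV[C]_n.

(* Locked, because comparing two distinct derivatives up to conversion would
   unfold them down to the filters that define limits. *)
Fact partial_key : unit. Proof. exact: tt. Qed.
Definition partial : 'I_n -> (T -> C^o) -> T -> C^o :=
  locked_with partial_key (fun a g z => 'D_(delta_mx ord0 a) g z).

Lemma partialE a (g : T -> C^o) z : partial a g z = 'D_(delta_mx ord0 a) g z.
Proof. by rewrite /partial unlock. Qed.

Lemma partial_cst a (c : C) z : partial a (fun=> c) z = 0.
Proof. by rewrite partialE; exact: derive_cst. Qed.

Lemma partialD a (g h : T -> C^o) z : differentiable g z -> differentiable h z ->
  partial a (fun y => g y + h y) z = partial a g z + partial a h z.
Proof. by move=> dg dh; rewrite !partialE; apply: deriveD; apply: diff_derivable. Qed.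

Lemma partialM a (g h : T -> C^o) z : differentiable g z -> differentiable h z ->
  partial a (fun y => g y * h y) z = partial a g z * h z + g z * partial a h z.
Proof.
move=> dg dh; rewrite !partialE; have := @deriveM _ _ g h z (delta_mx ord0 a).
by move=> ->; [rewrite addrC; congr (_ + _); exact: mulrC
  |exact: diff_derivable|exact: diff_derivable].
Qed.

Lemma partialV a (g : T -> C^o) z : differentiable g z -> g z != 0 ->
  partial a (fun y => (g y)^-1) z = - ((g z)^-1 * (g z)^-1 * partial a g z).
Proof.
move=> dg g0; rewrite !partialE; have := @deriveV _ _ g z (delta_mx ord0 a) g0.
move=> ->; last exact: diff_derivable.
by rewrite -exprVn expr2 -!mulNr.
Qed.

Lemma partial_coord a b z : partial a (fun y => y ord0 b) z = (b == a)%:R.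
Proof.
rewrite partialE deriveE; last exact: differentiable_coord.
by rewrite diff_rV_coord mxE eqxx.
Qed.

Lemma eq_partial (O : set T) a (g h : T -> C^o) : open O -> {in O, g =1 h} ->
  {in O, partial a g =1 partial a h}.
Proof.
move=> oO gh z; rewrite inE !partialE => Oz; apply: near_eq_derive.
by apply: filterS (open_nbhs_nbhs (conj oO Oz)) => y Oy; apply: gh; rewrite inE.
Qed.

End Partial.

Section Generated.
Variables (C : numFieldType) (n : nat).
Local Notation T := 'rV[C]_n.
Variables (O : set T) (f : T -> C^o).

(** A substitute for the ring of holomorphic functions on [O], small enough for properties to be
    proved by induction on the constructors. [gen_ext] is there because identities between functions
    hold only on [O]. *)
Inductive generated : (T -> C^o) -> Prop :=
| gen_cst c : generated (fun=> c)
| gen_coord a : generated (fun z => z ord0 a)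
| gen_base : generated f
| gen_add g h : generated g -> generated h -> generated (fun z => g z + h z)
| gen_mul g h : generated g -> generated h -> generated (fun z => g z * h z)
| gen_inv g : generated g -> {in O, forall z, g z != 0} ->
    generated (fun z => (g z)^-1)
| gen_ext g h : generated g -> {in O, g =1 h} -> generated h.

Hypothesis openO : open O.
Hypothesis diff_f : {in O, forall z, differentiable f z}.
Hypothesis gen_f : forall a, generated (partial a f).
Hypothesis comm_f : forall a b,
  {in O, partial a (partial b f) =1 partial b (partial a f)}.

Lemma gen_diff g : generated g -> {in O, forall z, differentiable g z}.
Proof.
elim=> {g} [c|a||g h _ dg _ dh|g h _ dg _ dh|g _ dg g0|g h _ dg gh] z Oz.
- exact: differentiable_cst.
- exact: differentiable_coord.
- exact: diff_f.
- by apply: differentiableD; [exact: dg|exact: dh].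
- by apply: differentiableM; [exact: dg|exact: dh].
- by apply: differentiableV; [exact: dg|exact: g0].
- apply/(near_eq_differentiable _ (dg z Oz)); near=> y; apply: gh; rewrite inE; near: y.
  by apply: open_nbhs_nbhs; split=> //; rewrite inE in Oz.
Unshelve. all: by end_near. Qed.

(** With [gen_diff] this yields derivatives of all orders: the rules for sums, products and inverses
    stay in the ring, and [gen_f] covers the one generator whose derivative is not explicit. *)
Lemma gen_partial a g : generated g -> generated (partial a g).
Proof.
elim=> {g} [c|b||g h gg dg gh dh|g h gg dg gh dh|g gg dg g0|g h gg dg gh].
- by apply: gen_ext (gen_cst 0) _ => z _; rewrite partial_cst.
- by apply: gen_ext (gen_cst (b == a)%:R) _ => z _; rewrite partial_coord.
- exact: gen_f.
- apply: gen_ext (gen_add dg dh) _ => z Oz.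
  by rewrite partialD//; exact: gen_diff.
- apply: gen_ext (gen_add (gen_mul dg gh) (gen_mul gg dh)) _ => z Oz.
  by rewrite partialM//; exact: gen_diff.
- have gV := gen_inv gg g0.
  apply: gen_ext (gen_mul (gen_cst (-1)) (gen_mul (gen_mul gV gV) dg)) _ => z Oz.
  by rewrite partialV ?mulN1r ?g0//; exact: gen_diff.
- exact: gen_ext dg (eq_partial a openO gh).
Qed.

Lemma partial_partial_cst a b (c : C) :
  {in O, partial a (partial b (fun=> c)) =1 (fun=> 0)}.
Proof.
move=> z Oz; have P0 : {in O, partial b (fun=> c : C^o) =1 (fun=> 0)}.
  by move=> y _; rewrite partial_cst.
by rewrite (eq_partial _ openO P0 Oz) partial_cst.
Qed.

(** The terms are grouped so that the last bracket is symmetric in [a] and [b] and drops out of the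
    commutator. *)
Lemma partial_partialM a b g h : generated g -> generated h ->
  {in O, partial a (partial b (fun y => g y * h y)) =1
    fun y => partial a (partial b g) y * h y + g y * partial a (partial b h) y
      + (partial b g y * partial a h y + partial a g y * partial b h y)}.
Proof.
move=> gg gh z Oz; have gpg := gen_partial b gg; have gph := gen_partial b gh.
have P0 : {in O, partial b (fun y => g y * h y) =1
    (fun y => partial b g y * h y + g y * partial b h y)}.
  by move=> y Oy; rewrite partialM//; exact: gen_diff.
rewrite (eq_partial _ openO P0 Oz) partialD; last first.
- exact: gen_diff (gen_mul gg gph) _ Oz.
- exact: gen_diff (gen_mul gpg gh) _ Oz.
rewrite (partialM a (gen_diff gpg Oz) (gen_diff gh Oz)).
rewrite (partialM a (gen_diff gg Oz) (gen_diff gph Oz)) /=.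
by rewrite -!addrA; congr (_ + _); rewrite [RHS]addrC addrA.
Qed.

(* The commutator of two partial derivatives is a derivation of the ring of
   generated functions, so it vanishes as soon as it kills the generators. *)
Lemma partialC a b g : generated g ->
  {in O, partial a (partial b g) =1 partial b (partial a g)}.
Proof.
elim=> {g} [c|e||g h gg dg gh dh|g h gg dg gh dh|g gg dg g0|g h gg dg gh] z Oz.
- by rewrite !partial_partial_cst.
- have P0 i : {in O, partial i (fun y => y ord0 e : C^o) =1 (fun=> (e == i)%:R : C^o)}.
    by move=> y _; rewrite partial_coord.
  by rewrite !(eq_partial _ openO (P0 _) Oz) !partial_cst.
- exact: comm_f.
- have P0 i : {in O, partial i (fun y => g y + h y : C^o) =1
      (fun y => partial i g y + partial i h y)}.
    by move=> y Oy; rewrite partialD//; exact: gen_diff.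
  have D i k (gk : generated k) := gen_diff (gen_partial i gk) Oz.
  rewrite !(eq_partial _ openO (P0 _) Oz).
  rewrite (partialD a (D b g gg) (D b h gh)) (partialD b (D a g gg) (D a h gh)).
  by rewrite (dg z Oz) (dh z Oz).
- rewrite (partial_partialM a b gg gh Oz) (partial_partialM b a gg gh Oz).
  rewrite (dg z Oz) (dh z Oz); congr (_ + _); exact: addrC.
- have gV := gen_inv gg g0.
  (* The commutator kills the constant [g * g^-1 = 1]. As it also kills [g], the product formula
     leaves [g] times the commutator applied to [g^-1], and [g] does not vanish. *)
  have P1 : {in O, (fun y => g y * (g y)^-1) =1 fun=> 1}.
    by move=> y Oy; rewrite divff ?g0.
  have P2 i j : partial i (partial j (fun y => g y * (g y)^-1)) z = 0.
    rewrite (eq_partial _ openO (eq_partial _ openO P1) Oz).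
    exact: partial_partial_cst Oz.
  have := etrans (P2 a b) (esym (P2 b a)).
  rewrite (partial_partialM a b gg gV Oz) (partial_partialM b a gg gV Oz).
  rewrite (dg z Oz) => /eqP.
  rewrite [partial a g z * _ + _]addrC (inj_eq (addIr _)) (inj_eq (addrI _)).
  by rewrite (inj_eq (mulfI (g0 z Oz))) => /eqP.
- have P0 i : {in O, partial i h =1 partial i g}.
    by move=> y Oy; rewrite (eq_partial _ openO gh Oy).
  by rewrite !(eq_partial _ openO (P0 _) Oz) (dg z Oz).
Qed.


Lemma partials_cons (g : T -> C^o) a s :
  partials g (a :: s) = partial a (partials g s).
Proof. by apply/funext => z; rewrite partialE. Qed.

Lemma partials_cat s t (g : T -> C^o) :
  partials g (s ++ t) = partials (partials g t) s.
Proof. exact: foldr_cat. Qed.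

Lemma gen_partials s g : generated g -> generated (partials g s).
Proof.
move=> gg; elim: s => [|a s gs]; first exact: gg.
by rewrite partials_cons; exact: gen_partial.
Qed.

Lemma eq_partials s g h : {in O, g =1 h} -> {in O, partials g s =1 partials h s}.
Proof.
move=> gh; elim: s => [|a s IH]; first exact: gh.
by rewrite !partials_cons; exact: eq_partial.
Qed.

Lemma partials_partial a s g : generated g ->
  {in O, partials (partial a g) s =1 partials g (a :: s)}.
Proof.
move=> gg; elim: s => [|b s IH] z Oz; first by rewrite partials_cons.
rewrite !partials_cons (eq_partial b openO IH Oz) partials_cons.
by rewrite (partialC b a (gen_partials s gg) Oz).
Qed.

Lemma partials_catC s t g : generated g ->
  {in O, partials g (s ++ t) =1 partials g (t ++ s)}.
Proof.
move=> gg; elim: s => [|a s IH] z Oz; first by rewrite cats0.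
rewrite cat_cons partials_cons (eq_partial a openO IH Oz).
rewrite (partials_cat t (a :: s)) partials_cons
  (partials_partial a t (gen_partials s gg) Oz).
by rewrite partials_cons -partials_cat.
Qed.

Lemma perm_partials g s t : generated g -> perm_eq s t ->
  {in O, partials g s =1 partials g t}.
Proof.
move=> gg st; pose P u := {in O, partials g s =1 partials g u}.
(* Permutations are generated by exchanges of two leading blocks [s1] and [s2]; these act on the
   generated function [partials g s3]. *)
apply: (@catCA_perm_ind _ P _ _ _ st) => [s1 s2 s3 IH z Oz|z _]; last by [].
rewrite (IH z Oz) !catA (partials_cat (s1 ++ s2)) (partials_cat (s2 ++ s1)).
exact: (partials_catC s1 s2 (gen_partials s3 gg) Oz).
Qed.

(** * Jets *)

(* Up to the factor k!, the homogeneous part of degree k of the Taylor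
   expansion of g at z. *)
Definition jet (g : T -> C^o) (z : T) (k : nat) : mpoly n C :=
  form_poly (fun t : k.-tuple 'I_n => partials g t z).

Lemma eq_jet g h z k : O z -> {in O, g =1 h} -> jet g z k = jet h z k.
Proof.
by move=> Oz gh; apply: eq_bigr => t _; rewrite (eq_partials t gh) ?inE.
Qed.

Lemma jet0 g z : jet g z 0 = mpolyC n (g z).
Proof.
rewrite /jet /form_poly (big_pred1 [tuple]) => [|t]; last first.
  by apply/esym/eqP; rewrite [t]tuple0.
by rewrite big_nil -mul_mpolyC mulr1.
Qed.

(** Splits off the first index of each tuple. This recursion reduces statements on jets to the rules
    for one partial derivative. *)
Lemma jetS g z k : generated g -> O z ->
  jet g z k.+1 = \sum_a mpolyX C (mnm1 a) * jet (partial a g) z k.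
Proof.
move=> gg Oz; under eq_bigr do rewrite /jet /form_poly mulr_sumr.
rewrite pair_bigA /= /jet /form_poly.
rewrite (reindex (fun p : 'I_n * k.-tuple 'I_n => [tuple of p.1 :: p.2])) /=; last first.
  exists (fun t => (thead t, [tuple of behead t])) => [[a t] _|t _].
    by congr pair => //; apply: val_inj.
  by rewrite [RHS]tuple_eta; apply: val_inj.
apply: eq_bigr => -[a t] _ /=; rewrite big_cons.
by rewrite (partials_partial a t gg) ?inE// -scalerAr.
Qed.

Lemma jetD g h z k : generated g -> generated h -> O z ->
  jet (fun y => g y + h y) z k = jet g z k + jet h z k.
Proof.
elim: k g h => [|k IH] g h gg gh Oz; first by rewrite !jet0 mpolyCD.
rewrite !jetS//; last exact: gen_add.
rewrite -big_split; apply: eq_bigr => a _; rewrite /= -mulrDr; congr (_ * _).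
rewrite -IH //; try exact: gen_partial.
by apply: eq_jet => // y Oy; rewrite partialD//; exact: gen_diff Oy.
Qed.

Lemma jet_cst c z k : O z -> (0 < k)%N -> jet (fun=> c) z k = 0.
Proof.
move=> Oz; elim: k c => [//|[|k] IH] c _; rewrite jetS//; try exact: gen_cst.
  by rewrite big1// => a _; rewrite jet0 partial_cst mpolyC0 mulr0.
rewrite big1// => a _; rewrite (@eq_jet _ (fun=> 0)) ?IH ?mulr0//.
by move=> y _; rewrite partial_cst.
Qed.

(** Leibniz' formula; the binomial coefficients appear because jets are not divided by factorials.
    Induction on [k]: differentiate the product once, then apply [pascal_sum]. *)
Lemma jetM g h z k : generated g -> generated h -> O z ->
  jet (fun y => g y * h y) z k =
  \sum_(i < k.+1) (jet g z i * jet h z (k - i)) *+ 'C(k, i).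
Proof.
elim: k g h => [|k IH] g h gg gh Oz.
  by rewrite big_ord1 !jet0 mpolyCM.
rewrite jetS//; last exact: gen_mul.
rewrite -(pascal_sum (fun i j => jet g z i * jet h z j)).
under [RHS]eq_bigr => i _ do rewrite !jetS// mulr_suml mulr_sumr -big_split -sumrMnl/=.
rewrite exchange_big; apply: eq_bigr => a _ /=.
have gpg := gen_partial a gg; have gph := gen_partial a gh.
rewrite (@eq_jet _ (fun y => partial a g y * h y + g y * partial a h y))//; last first.
  by move=> y Oy; rewrite partialM//; exact: gen_diff Oy.
rewrite jetD ?IH//; try exact: gen_mul.
rewrite -big_split mulr_sumr; apply: eq_bigr => i _ /=.
by rewrite -mulrnDl mulrnAr; congr (_ *+ _); rewrite mulrDr mulrA mulrCA.
Qed.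

Lemma jetZ c g z k : generated g -> O z ->
  jet (fun y => c * g y) z k = c *: jet g z k.
Proof.
move=> gg Oz; rewrite (jetM _ (gen_cst c) gg Oz) big_ord_recl big1 => [|i _].
  by rewrite jet0 bin0 subn0 mulr1n addr0 mul_mpolyC.
by rewrite jet_cst// mul0r mul0rn.
Qed.

(** * Polynomials in generated functions *)

Variables (N : nat) (x : 'I_N -> T -> C^o).
Hypothesis gen_x : forall j, generated (x j).

Definition peval (p : mpoly N C) : T -> C^o := fun z => meval (x^~ z) p.

Lemma gen_peval p : generated (peval p).
Proof.
elim/mpoly_alg_ind: p => [||j p gp|c p q gp gq].
- by apply: gen_ext (gen_cst 0) _ => z _; rewrite /peval meval0.
- by apply: gen_ext (gen_cst 1) _ => z _; rewrite /peval meval1.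
- apply: gen_ext (gen_mul (gen_x j) gp) _ => z _.
  by rewrite /peval mevalM mevalXU.
- apply: gen_ext (gen_add (gen_mul (gen_cst c) gp) gq) _ => z _.
  by rewrite /peval mevalD mevalZ.
Qed.

Lemma partial_peval a p : {in O, partial a (peval p) =1
  fun z => \sum_j peval (mderiv j p) z * partial a (x j) z}.
Proof.
elim/mpoly_alg_ind: p => [||j p IH|c p q IHp IHq] z Oz.
- rewrite big1 => [|j _]; last by rewrite mderiv0 /peval meval0 mul0r.
  rewrite (_ : peval 0 = fun=> 0) ?partial_cst//.
  by apply/funext => y; exact: meval0.
- rewrite big1 => [|j _]; last by rewrite -mpolyC1 mderivC /peval meval0 mul0r.
  rewrite (_ : peval 1 = fun=> 1) ?partial_cst//.
  by apply/funext => y; exact: meval1.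
- rewrite (_ : peval _ = fun y => x j y * peval p y); last first.
    by apply/funext => y; rewrite /peval mevalM mevalXU.
  rewrite partialM; try by apply: gen_diff => //; exact: gen_peval.
  under eq_bigr => i _ do rewrite mderivM /peval mevalD !mevalM mulrDl mevalXU -!mulrA.
  rewrite big_split /= -mulr_sumr (IH z Oz); congr (_ + _).
  rewrite (bigD1 j) //= mderivXU eqxx meval1 mul1r big1 ?addr0 => [|i ij].
    by rewrite mulrC.
  by rewrite mderivXU (negbTE ij) meval0 mul0r.
- rewrite (_ : peval _ = fun y => c * peval p y + peval q y); last first.
    by apply/funext => y; rewrite /peval mevalD mevalZ.
  rewrite partialD; try by apply: gen_diff => //;
    repeat (exact: gen_peval || apply: gen_mul || apply: gen_cst).
  rewrite partialM; try by apply: gen_diff => //;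
    repeat (exact: gen_peval || apply: gen_mul || apply: gen_cst).
  rewrite partial_cst mul0r add0r (IHp z Oz) (IHq z Oz) mulr_sumr -big_split.
  by apply: eq_bigr => j _ /=; rewrite mderivD mderivZ /peval mevalD mevalZ mulrDl mulrA.
Qed.


(** * The ideal generated by the jets of orders 2 to d *)

Variables (d : nat) (z : T).
Hypothesis Oz : O z.

(** The ideal of [F_2], ..., [F_d] without the signs [(-1)^k], which [fubini_in_ideal] puts back. *)
Definition jet_ideal (p : mpoly n C) : Prop :=
  exists c : nat -> mpoly n C, p = \sum_(2 <= k < d.+1) c k * jet f z k.

Lemma jet_ideal0 : jet_ideal 0.
Proof. by exists (fun=> 0); rewrite big1 // => k _; rewrite mul0r. Qed.

Lemma jet_idealD p q : jet_ideal p -> jet_ideal q -> jet_ideal (p + q).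
Proof.
move=> [c ->] [c' ->]; exists (fun k => c k + c' k).
by rewrite -big_split; apply: eq_bigr => k _; rewrite mulrDl.
Qed.

Lemma jet_idealM p q : jet_ideal p -> jet_ideal (q * p).
Proof.
move=> [c ->]; exists (fun k => q * c k).
by rewrite mulr_sumr; apply: eq_bigr => k _; rewrite mulrA.
Qed.

Lemma jet_idealZ c p : jet_ideal p -> jet_ideal (c *: p).
Proof. by rewrite -mul_mpolyC; exact: jet_idealM. Qed.

Lemma jet_ideal_jet k : (1 < k <= d)%N -> jet_ideal (jet f z k).
Proof.
move=> /andP[k1 kd]; exists (fun i => (i == k)%:R).
rewrite (bigD1_seq k) ?iota_uniq //=; last by rewrite mem_index_iota k1.
by rewrite eqxx mul1r big1 ?addr0// => i /negbTE ->; rewrite mul0r.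
Qed.

(** Models the coordinates of [e_0(z)]: the function [x j] is to differ from [mu j] times [f] by an
    affine function, which is invisible from order two on. *)
Variable mu : 'I_N -> C.
Hypothesis jet_x : forall j k, (1 < k)%N -> jet (x j) z k = mu j *: jet f z k.

Lemma jet_ideal_x j k : (1 < k <= d)%N -> jet_ideal (jet (x j) z k).
Proof.
move=> kd; case/andP: (kd) => k1 _; rewrite jet_x//.
by apply: jet_idealZ; exact: jet_ideal_jet.
Qed.

(* Modulo the ideal, Leibniz' formula leaves only the terms that differentiate
   one of the at most d factors d + 1 times. *)
Lemma jet_peval_deg r p : {in msupp p, forall m, (mdeg m <= r)%N} -> (r <= d)%N ->
  (forall k, (r < k <= d)%N -> jet_ideal (jet (peval p) z k)) /\
  jet_ideal (jet (peval p) z d.+1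
    - (\sum_j mu j * peval (mderiv j p) z) *: jet f z d.+1).
Proof.
elim/mpoly_deg_ind: r p / => [_|r j p IH rd|r _|r s p rs IH sd|r c p q IHp IHq rd].
- have jet1 k : (0 < k)%N -> jet (peval 1) z k = 0.
    by move=> k0; rewrite (@eq_jet _ (fun=> 1)) ?jet_cst// => y _; exact: meval1.
  split=> [k /andP[k0 _]|]; first by rewrite jet1//; exact: jet_ideal0.
  rewrite jet1// big1 => [|j _]; last by rewrite -mpolyC1 mderivC /peval meval0 mulr0.
  by rewrite scale0r subr0; exact: jet_ideal0.
- have [IH1 IH2] := IH (ltnW rd).
  have jetE k : jet (peval (mpolyX C (mnm1 j) * p)) z k =
      \sum_(i < k.+1) (jet (x j) z i * jet (peval p) z (k - i)) *+ 'C(k, i).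
    rewrite -jetM//; last exact: gen_peval.
    by apply: eq_jet => // y _; rewrite /peval mevalM mevalXU.
  split=> [k /andP[rk kd]|].
    (* For [i = 0] and [i = 1] the jet of [p] still has order at least [k - 1 > r], so the induction
       hypothesis applies; for [i >= 2] the jet of [x j] lies in the ideal. *)
    rewrite jetE; elim/big_ind: _ => [|p1 p2|[[|[|i]] /= ik] _].
    - exact: jet_ideal0.
    - exact: jet_idealD.
    - rewrite bin0 subn0 mulr1n; apply: jet_idealM; apply: IH1.
      by rewrite (ltnW rk).
    - rewrite -mulrnAl; apply: jet_idealM; apply: IH1.
      by rewrite subn1 -ltnS (ltn_predK rk) rk (leq_trans (leq_pred _)).
    - rewrite mulrC -mulrnAl; apply: jet_idealM; apply: jet_ideal_x.
      by rewrite /= (leq_trans _ kd).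
  have dS : \sum_i mu i * peval (mderiv i (mpolyX C (mnm1 j) * p)) z =
      mu j * peval p z + x j z * \sum_i mu i * peval (mderiv i p) z.
    under eq_bigr => i _ do
      rewrite mderivM /peval mevalD !mevalM mevalXU mulrDr [X in _ + X]mulrCA.
    rewrite big_split /= -mulr_sumr; congr (_ + _).
    rewrite (bigD1 j) //= mderivXU eqxx meval1 mul1r big1 ?addr0// => i ij.
    by rewrite mderivXU (negbTE ij) meval0 mul0r mulr0.
  (* The terms [i = 0] and [i = d + 1] carry the two halves of [dS]. The rest, [S], lies in the
     ideal: for [i = 1] the jet of [p] has order [d > r], and for [2 <= i <= d] that of [x j] is in
     the ideal. *)
  rewrite dS jetE big_ord_recl big_ord_recr /= bin0 subn0 !jet0 mulr1n.
  rewrite /bump leq0n add1n subnn jet0 binn mulr1n jet_x;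
    last by rewrite ltnS (leq_ltn_trans _ rd).
  rewrite mul_mpolyC [_ * mpolyC _ _]mulrC mul_mpolyC.
  set S := \sum_(i < d) _.
  rewrite (_ : _ - _ = x j z *: (jet (peval p) z d.+1
      - (\sum_i mu i * peval (mderiv i p) z) *: jet f z d.+1) + S); last first.
    rewrite scalerBr scalerDl !scalerA [peval p z * _]mulrC.
    rewrite [X in X - _]addrCA -addrA [RHS]addrC; congr (_ + _).
    by rewrite [X in _ - X]addrC opprD addrACA subrr addr0.
  apply: jet_idealD; first exact: jet_idealZ.
  rewrite /S; elim/big_ind: _ => [|p1 p2|i _].
  - exact: jet_ideal0.
  - exact: jet_idealD.
  rewrite /bump leq0n add1n subSS; case: i => -[|i] /= id.
    rewrite -mulrnAl; apply: jet_idealM; apply: IH1.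
    by rewrite subn0 rd leqnn.
  rewrite mulrC -mulrnAl; apply: jet_idealM; apply: jet_ideal_x.
  by rewrite /= id.
- have jet_0 k : jet (peval 0) z k = 0.
    rewrite (@eq_jet _ (fun y => 0 * peval 0 y))//; last first.
      by move=> y _; rewrite mul0r; exact: meval0.
    by rewrite jetZ ?scale0r//; exact: gen_peval.
  split=> [k _|]; first by rewrite jet_0; exact: jet_ideal0.
  rewrite jet_0 big1 => [|j _]; last by rewrite mderiv0 /peval meval0 mulr0.
  by rewrite scale0r subr0; exact: jet_ideal0.
- have [IH1 IH2] := IH (leq_trans rs sd); split=> // k /andP[sk kd].
  by apply: IH1; rewrite kd (leq_ltn_trans rs).
- have [IHp1 IHp2] := IHp rd; have [IHq1 IHq2] := IHq rd.
  have gp := gen_peval p; have gq := gen_peval q.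
  have jetE k : jet (peval (c *: p + q)) z k =
      c *: jet (peval p) z k + jet (peval q) z k.
    rewrite -jetZ// -jetD//; last exact: gen_mul (gen_cst c) gp.
    by apply: eq_jet => // y _; rewrite /peval mevalD mevalZ.
  split=> [k /andP[rk kd]|].
    rewrite jetE; apply: jet_idealD.
      by apply: jet_idealZ; apply: IHp1; rewrite rk.
    by apply: IHq1; rewrite rk.
  rewrite jetE (_ : _ - _ = c *: (jet (peval p) z d.+1
      - (\sum_i mu i * peval (mderiv i p) z) *: jet f z d.+1) + (jet (peval q) z d.+1
      - (\sum_i mu i * peval (mderiv i q) z) *: jet f z d.+1)).
    by apply: jet_idealD; first exact: jet_idealZ.
  rewrite scalerBr addrACA -opprD scalerA -scalerDl mulr_sumr -big_split.
  congr (_ - _ *: _); apply: eq_bigr => i _ /=.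
  by rewrite mderivD mderivZ /peval mevalD mevalZ mulrDr mulrCA.
Qed.

End Generated.

(** * Finite sums and scalar multiples of generated functions *)

Section Sums.
Variables (C : numFieldType) (n : nat).
Local Notation T := 'rV[C]_n.
Variables (O : set T) (f : T -> C^o).
Hypothesis openO : open O.
Hypothesis diff_f : {in O, forall z, differentiable f z}.

Lemma gen_sum (I : Type) (r : seq I) (g : I -> T -> C^o) :
  (forall i, generated O f (g i)) -> generated O f (fun z => \sum_(i <- r) g i z).
Proof.
move=> gg; elim: r => [|i r IH].
  by apply: gen_ext (gen_cst _ _ 0) _ => z _; rewrite big_nil.
by apply: gen_ext (gen_add (gg i) IH) _ => z _; rewrite big_cons.
Qed.

Lemma partial_sum (I : Type) (r : seq I) (g : I -> T -> C^o) a :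
  (forall i, generated O f (g i)) ->
  {in O, partial a (fun z => \sum_(i <- r) g i z) =1
    fun z => \sum_(i <- r) partial a (g i) z}.
Proof.
move=> gg z Oz; elim: r => [|i r IH].
  rewrite big_nil (@eq_partial _ _ O a _ (fun=> 0)) ?partial_cst// => y _.
  by rewrite big_nil.
rewrite big_cons -IH.
rewrite -(partialD a (gen_diff openO diff_f (gg i) Oz)
  (gen_diff openO diff_f (gen_sum r gg) Oz)).
by apply: (eq_partial a openO _ Oz) => y _; rewrite big_cons.
Qed.

Lemma gen_scale (c : C) (g : T -> C^o) :
  generated O f g -> generated O f (fun z => c * g z).
Proof. exact: gen_mul (gen_cst _ _ c). Qed.

Lemma partial_scale (c : C) (g : T -> C^o) a : generated O f g ->
  {in O, partial a (fun z => c * g z) =1 fun z => c * partial a g z}.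
Proof.
move=> gg z Oz.
rewrite (partialM a (gen_diff openO diff_f (gen_cst O f c) Oz)
  (gen_diff openO diff_f gg Oz)).
by rewrite partial_cst mul0r add0r.
Qed.

End Sums.

(** * The graph of the hypersurface *)

Section Graph.
Variables (C : numFieldType) (n : nat) (Q : mpoly n.+2 C) (A : 'M[C]_n.+2).
Local Notation T := 'rV[C]_n.
Variables (O : set T) (f : T -> C^o).
Hypothesis openO : open O.
Hypothesis diff_f : {in O, forall z, differentiable f z}.

Definition frame_coord (j : 'I_n.+2) : T -> C^o := fun z => frame0 A f z ord0 j.

Lemma frame_coordE j z : frame_coord j z =
  A ord0 j + \sum_(b < n) A (inord b.+1) j * z ord0 b + A ord_max j * f z.
Proof.
rewrite /frame_coord /frame0 /chart_point !mxE summxE [f z * _]mulrC.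
by congr (_ + _ + _); apply: eq_bigr => b _; rewrite !mxE mulrC.
Qed.

Lemma gen_frame_coord j : generated O f (frame_coord j).
Proof.
have g1 (b : 'I_n) := gen_scale (A (inord b.+1) j) (gen_coord O f b).
have g2 := gen_add (gen_cst O f (A ord0 j)) (gen_sum (index_enum _) g1).
apply: gen_ext (gen_add g2 (gen_scale (A ord_max j) (gen_base O f))) _ => z _.
by rewrite frame_coordE.
Qed.

Lemma partial_frame_coord a j : {in O, partial a (frame_coord j) =1
  fun z => A (inord a.+1) j + A ord_max j * partial a f z}.
Proof.
move=> z Oz.
have g1 (b : 'I_n) := gen_scale (A (inord b.+1) j) (gen_coord O f b).
have g2 := gen_sum (index_enum _) g1.
have g3 := gen_add (gen_cst O f (A ord0 j)) g2.
have g4 := gen_scale (A ord_max j) (gen_base O f).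
have -> : frame_coord j = fun y => (A ord0 j + \sum_(b < n) A (inord b.+1) j * y ord0 b)
   + A ord_max j * f y by apply/funext => y; exact: frame_coordE.
rewrite (partialD a (gen_diff openO diff_f g3 Oz) (gen_diff openO diff_f g4 Oz)).
rewrite (partial_scale openO diff_f _ a (gen_base O f) Oz); congr (_ + _).
rewrite (partialD a (gen_diff openO diff_f (gen_cst O f _) Oz)
  (gen_diff openO diff_f g2 Oz)).
rewrite partial_cst add0r (partial_sum openO diff_f _ a g1 Oz) (bigD1 a)//=.
rewrite (partial_scale openO diff_f _ a (gen_coord O f a) Oz) partial_coord eqxx mulr1.
rewrite big1 ?addr0// => b /negbTE ba.
by rewrite (partial_scale openO diff_f _ a (gen_coord O f b) Oz) partial_coord ba mulr0.
Qed.

Local Notation eval := (peval frame_coord).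

Hypothesis Q0 : {in O, eval Q =1 fun=> 0}.

(** The derivative of [Q] at [e_0(z)] along the [i]-th coordinate vector. *)
Definition dframe (i : 'I_n.+2) : T -> C^o :=
  fun z => \sum_j A i j * eval (mderiv j Q) z.

(** The Hessian of [Q] at [e_0(z)], evaluated on the coordinate vectors [i] and [l]. *)
Definition hframe (i l : 'I_n.+2) (z : T) : C :=
  \sum_j \sum_k A i j * A l k * eval (mderiv k (mderiv j Q)) z.

Lemma hframe_sym i l z : hframe i l z = hframe l i z.
Proof.
rewrite /hframe exchange_big; apply: eq_bigr => k _; apply: eq_bigr => j _.
by rewrite mderiv_comm [A i _ * _]mulrC.
Qed.

Lemma gen_dframe i : generated O f (dframe i).
Proof. by apply: gen_sum => j; apply: gen_scale; exact: gen_peval gen_frame_coord _. Qed.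

Lemma partial_eval a p : {in O, partial a (eval p) =1
  fun z => \sum_j A (inord a.+1) j * eval (mderiv j p) z
    + partial a f z * \sum_j A ord_max j * eval (mderiv j p) z}.
Proof.
move=> z Oz; rewrite (partial_peval openO diff_f gen_frame_coord a p Oz).
rewrite mulr_sumr -big_split; apply: eq_bigr => j _ /=.
by rewrite (partial_frame_coord _ _ Oz) mulrDr mulrC; congr (_ + _); rewrite mulrC mulrAC mulrC.
Qed.

(** The derivative of [Q(e_0(z)) = 0] along [z^a]; in other words, the gradient of [Q] kills
    [e_a]. *)
Lemma dframe_tangent (a : 'I_n) : {in O, (fun z => dframe (inord a.+1) z
  + partial a f z * dframe ord_max z) =1 fun=> 0}.
Proof.
move=> z Oz; rewrite -(partial_eval a Q Oz).
by rewrite (eq_partial a openO Q0 Oz) partial_cst.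
Qed.

Lemma partial_dframe (a : 'I_n) i : {in O, partial a (dframe i) =1
  fun z => hframe i (inord a.+1) z + partial a f z * hframe i ord_max z}.
Proof.
move=> z Oz; have ge j := gen_peval gen_frame_coord (mderiv j Q).
rewrite (partial_sum openO diff_f _ a (fun j => gen_scale (A i j) (ge j)) Oz).
rewrite mulr_sumr -big_split; apply: eq_bigr => j _ /=.
rewrite (partial_scale openO diff_f _ a (ge j) Oz) (partial_eval _ _ Oz).
rewrite mulrDr mulrCA !mulr_sumr; congr (_ + _).
  by apply: eq_bigr => k _; rewrite mulrA.
by apply: eq_bigr => k _; rewrite !mulrA.
Qed.

Variable e : nat.
Hypothesis homQ : Q \is ishomog1 e mdeg.
Hypothesis unitA : A \in unitmx.
Hypothesis smoothO : {in O, forall z, grad Q (frame0 A f z) != 0}.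

(* If the derivative along the last vector vanished, so would those along the
   others: for z^1, ..., z^n by differentiating Q = 0, then for z^0 by Euler. *)
Lemma dframe_max_neq0 : {in O, forall z, dframe ord_max z != 0}.
Proof.
move=> z Oz; apply/eqP => qN; move/eqP: (smoothO Oz); apply.
have qa (a : 'I_n) : dframe (inord a.+1) z = 0.
  by have := dframe_tangent a Oz; rewrite qN mulr0 addr0.
have q0 : dframe ord0 z = 0.
  have : eval (Q *+ e) z = 0 by rewrite /peval mevalMn [meval _ _](Q0 Oz) mul0rn.
  rewrite -(euler_dhomog homQ) /peval raddf_sum /=.
  under eq_bigr => j _ do
    rewrite mevalM mevalXU frame_coordE !mulrDl mulr_suml -(mulrA _ (f z))
      (mulrCA _ (f z)).
  rewrite !big_split /= exchange_big /= -mulr_sumr [X in _ + f z * X]qN mulr0 addr0.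
  rewrite [X in _ + X]big1 ?addr0// => b _.
  transitivity (z ord0 b * dframe (inord b.+1) z); last by rewrite qa mulr0.
  by rewrite mulr_sumr; apply: eq_bigr => j _; rewrite -mulrA mulrCA.
(* An index in ['I_n.+2] is [0], the last one, or [a.+1] with [a : 'I_n]. *)
have qi i : dframe i z = 0.
  case: (unliftP ord0 i) => [j ->|-> //]; case: (unliftP ord_max j) => [a ->|->].
    rewrite -[RHS](qa a); congr (dframe _ z); apply: val_inj.
    by rewrite /= inordK ?ltnS ?(ltnW (ltn_ord a))// /bump (leqNgt n) ltn_ord.
  by rewrite -[RHS]qN; congr (dframe _ z); apply: val_inj.
have : A *m (grad Q (frame0 A f z))^T = 0.
  apply/matrixP => i k; rewrite [LHS]mxE [RHS]mxE -[RHS](qi i).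
  by apply: eq_bigr => j _; rewrite !mxE.
by move/(congr1 (mulmx (invmx A))); rewrite mulKmx// mulmx0 => /(congr1 trmx);
  rewrite trmxK trmx0.
Qed.

(** The implicit function formula, from [dframe_tangent]. It exhibits the derivatives of [f] as
    quotients in the generated ring, which provides [gen_f]. *)
Lemma partial_graph (a : 'I_n) : {in O,
  (fun z => - dframe (inord a.+1) z * (dframe ord_max z)^-1)
  =1 partial a f}.
Proof.
move=> z Oz; have /eqP := dframe_tangent a Oz.
by rewrite addrC addr_eq0 => /eqP <-; rewrite mulfK// dframe_max_neq0.
Qed.

Lemma gen_graph a : generated O f (partial a f).
Proof.
apply: gen_ext (partial_graph a).
apply: gen_mul; last exact: gen_inv (gen_dframe _) dframe_max_neq0.
by apply: gen_ext (gen_scale (-1) (gen_dframe (inord a.+1))) _ => z _; rewrite mulN1r.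
Qed.

Lemma comm_graph (a b : 'I_n) :
  {in O, partial a (partial b f) =1 partial b (partial a f)}.
Proof.
move=> z Oz.
(* Differentiating [dframe_tangent] once more: the right-hand side is minus the Hessian of [Q] on
   [e_u] and [e_v], hence symmetric, and the factor [dframe ord_max z] can be cancelled. *)
have key (u v : 'I_n) : partial v (partial u f) z * dframe ord_max z =
  - (hframe (inord u.+1) (inord v.+1) z + partial v f z * hframe (inord u.+1) ord_max z
   + partial u f z * (hframe ord_max (inord v.+1) z
     + partial v f z * hframe ord_max ord_max z)).
  have gp := gen_mul (gen_graph u) (gen_dframe ord_max).
  have := eq_partial v openO (dframe_tangent u) Oz; rewrite partial_cst.
  rewrite (partialD v (gen_diff openO diff_f (gen_dframe (inord u.+1)) Oz)
    (gen_diff openO diff_f gp Oz)).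
  rewrite (partialM v (gen_diff openO diff_f (gen_graph u) Oz)
    (gen_diff openO diff_f (gen_dframe ord_max) Oz)).
  rewrite !(partial_dframe _ _ Oz) [X in _ + X]addrC addrA => /eqP.
  by rewrite addrC addr_eq0 => /eqP.
apply/eqP; rewrite -(inj_eq (mulIf (dframe_max_neq0 Oz))); apply/eqP.
rewrite (key b a) (key a b); congr (- _).
rewrite !mulrDr (hframe_sym (inord a.+1) (inord b.+1)).
rewrite (hframe_sym ord_max (inord a.+1)) (hframe_sym ord_max (inord b.+1)).
rewrite addrA [RHS]addrA; congr (_ + _); first by rewrite addrAC.
by rewrite mulrCA.
Qed.

End Graph.

(** * Fubini forms and the Gauss image *)

Section Components.
Variables (C : numFieldType) (n d : nat).

Lemma component_assemble (F : forall k, kform C n k) k (t : k.-tuple 'I_n) :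
  (1 < k <= d)%N -> component (assemble d F) k t = F k t.
Proof.
case: k t => [|[|k]] // t /andP[_ kd].
have kd' : (k < d.-1)%N by case: (d) kd.
(* The index [k] in ['I_d.-1] encodes the degree [k.+2]. *)
pose i0 : form_index n d :=
  Tagged (fun k : 'I_d.-1 => k.+2.-tuple 'I_n) (t : (Ordinal kd').+2.-tuple 'I_n).
rewrite /component (big_pred1 i0) => [|[k0 s]].
  by rewrite mxE enum_rankK.
rewrite /=; apply/eqP/eqP => [st|/(congr1 (fun i : form_index n d => tval (tagged i)))//].
have k0k : k0 = Ordinal kd'.
  by apply: val_inj; have := congr1 size st; rewrite !size_tuple => -[].
by subst k0; rewrite (val_inj st : s = t).
Qed.

Lemma component_out (P : forms_sum C n d) k (t : k.-tuple 'I_n) :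
  ~~ (1 < k <= d)%N -> component P k t = 0.
Proof.
move=> kd; rewrite /component big_pred0// => -[k0 s] /=.
apply/negbTE; apply: contra kd => /eqP/(congr1 size); rewrite !size_tuple => <-.
by case: k0 {s} => k0 /=; case: (d).
Qed.

Lemma in_degreeE k (P : kform C n k) (t : k.-tuple 'I_n) : in_degree P t = P t.
Proof. by rewrite /in_degree (big_pred1 t). Qed.

Lemma in_degree_out k l (P : kform C n k) (t : l.-tuple 'I_n) :
  l != k -> in_degree P t = 0.
Proof.
move=> lk; rewrite /in_degree big_pred0// => s.
by apply/negbTE; apply: contra lk => /eqP/(congr1 size); rewrite !size_tuple => ->.
Qed.

(** At most one summand is nonzero: the first in degrees up to [d], the second in degree [d.+1]. So
    for [alpha = F_{d+1}] the entries of [E_vector] have one formula in all degrees. *)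
Lemma component_in_degree (F : forall k, kform C n k) k (t : k.-tuple 'I_n) :
  (1 < k <= d.+1)%N -> (0 < d)%N ->
  component (assemble d F) k t + in_degree (F d.+1) t = F k t.
Proof.
case/andP=> k1; rewrite leq_eqVlt => /orP[/eqP kd|]; last first.
  rewrite ltnS => kd d0; rewrite component_assemble ?k1// in_degree_out ?addr0//.
  by rewrite neq_ltn ltnS kd.
move=> d0; subst k; rewrite component_out ?ltnn ?andbF//.
by rewrite in_degreeE add0r.
Qed.

Lemma form_polyZ k c (P : kform C n k) :
  form_poly (fun t => c * P t) = c *: form_poly P.
Proof. by rewrite scaler_sumr; apply: eq_bigr => t _; rewrite scalerA. Qed.

End Components.

Section Differential.
Variables (C : numFieldType) (n m : nat).
Local Notation T := 'rV[C]_n.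
Variables (g : T -> 'rV[C]_m) (z : T).
Hypothesis dg : forall j, differentiable (fun y => g y ord0 j : C^o) z.

Lemma differentiable_rV : differentiable g z.
Proof.
rewrite (_ : g = \sum_j (fun y => g y ord0 j *: delta_mx ord0 j)); last first.
  by apply/funext => y; rewrite fct_sumE; exact: row_sum_delta.
apply: differentiable_sum => j; exact: differentiableZl.
Qed.

Lemma diff_coord (v : T) j :
  ('d g z v) ord0 j = \sum_a v ord0 a * partial a (fun y => g y ord0 j) z.
Proof.
pose L := fun N : 'rV[C]_m => N ord0 j : C^o.
have -> : ('d g z v) ord0 j = 'd (L \o g) z v.
  have dL : differentiable L (g z) by exact: differentiable_coord.
  by rewrite (diff_comp differentiable_rV dL) diff_rV_coord.
rewrite {1}(row_sum_delta v) linear_sum; apply: eq_bigr => a _.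
by rewrite linearZ partialE deriveE //; exact: dg.
Qed.

Lemma diff_imageP (w : 'rV[C]_m) :
  w \in diff_image g z <->
  exists v : T, w = \row_j \sum_a v ord0 a * partial a (fun y => g y ord0 j) z.
Proof.
have E (v : T) : linfun ('d g z) v =
    \row_j \sum_a v ord0 a * partial a (fun y => g y ord0 j) z.
  by apply/rowP => j; rewrite lfunE mxE diff_coord.
split=> [/memv_imgP[v _ ->]|[v ->]]; first by exists v; exact: E.
by rewrite -E; apply: memv_img; exact: memvf.
Qed.

End Differential.

Section FubiniForms.
Variables (C : numFieldType) (n : nat).
Local Notation T := 'rV[C]_n.
Variables (O : set T) (f : T -> C^o).
Hypothesis openO : open O.
Hypothesis diff_f : {in O, forall z, differentiable f z}.
Hypothesis gen_f : forall a, generated O f (partial a f).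
Hypothesis comm_f : forall a b,
  {in O, partial a (partial b f) =1 partial b (partial a f)}.
Variables (d : nat) (z : T).
Hypothesis Oz : O z.

Lemma fubini_form_sym k : Defs.symmetric_form (fubini_form f z k).
Proof.
move=> s t st; congr (_ * _).
by apply: (perm_partials openO diff_f gen_f comm_f (gen_base O f) st); rewrite inE.
Qed.

Lemma fubini_map_sym : in_symmetric_sum (fubini_map d f z).
Proof.
move=> k s t st; have [kd|kd] := boolP (1 < k <= d)%N.
  by rewrite !component_assemble//; exact: fubini_form_sym.
by rewrite !component_out.
Qed.

Lemma fubini_map_is_E : (0 < d)%N ->
  is_E (fubini_map d f z) (fubini_form f z d.+1) (diff_image (fubini_map d f) z).
Proof.
move=> d0 w; have zO : z \in O by rewrite inE.
have gp s := gen_partials openO diff_f gen_f s (gen_base O f).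
have mapE j : (fun y => fubini_map d f y ord0 j) = fun y =>
    (-1) ^+ (tag (enum_val j)).+2 * partials f (tagged (enum_val j)) y.
  by apply/funext => y; rewrite mxE.
have dg j : differentiable (fun y => fubini_map d f y ord0 j : C^o) z.
  rewrite mapE; have gs := gen_scale ((-1) ^+ (tag (enum_val j)).+2)
    (gp (tagged (enum_val j))).
  exact: (gen_diff openO diff_f gs zO).
(* Because [F_k] carries the sign [(-1)^k], its derivative along [v] is the contraction of [F_{k+1}]
   with [-v]; as [v] runs over all of [T], the image is the same. *)
have EE v : E_vector (fubini_map d f z) (fubini_form f z d.+1) (- v) =
    \row_j \sum_a v ord0 a * partial a (fun y => fubini_map d f y ord0 j) z.
  apply/rowP => j; rewrite [LHS]mxE [RHS]mxE; apply: eq_bigr => a _.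
  rewrite component_in_degree//; last first.
    by case: (tag _) => k /=; case: (d).
  rewrite mapE (partial_scale openO diff_f _ a (gp _) zO) mxE /fubini_form.
  by rewrite partials_cons exprS mulN1r [X in _ * X]mulNr mulrNN.
split=> [/(diff_imageP dg)[v ->]|[v ->]].
  by exists (- v); rewrite EE.
by apply/(diff_imageP dg); exists (- v); rewrite -EE opprK.
Qed.

Lemma form_poly_fubini k : form_poly (fubini_form f z k) = (-1) ^+ k *: jet f z k.
Proof. exact: form_polyZ. Qed.

Lemma fubini_in_ideal : jet_ideal f d z (jet f z d.+1) ->
  in_ideal (fubini_map d f z) (fubini_form f z d.+1).
Proof.
(* The sign [(-1)^(d+1)] comes from [F_{d+1}], and [(-1)^k] cancels the sign of [F_k]. *)
move=> [c jE]; exists (fun k => (-1) ^+ d.+1 *: (-1) ^+ k *: c k).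
rewrite form_poly_fubini jE scaler_sumr; apply: eq_big_nat => k kd.
rewrite (_ : form_poly _ = (-1) ^+ k *: jet f z k); last first.
  rewrite -form_poly_fubini; apply: eq_bigr => t _; congr (_ *: _).
  exact: component_assemble.
by rewrite -!scalerAl -scalerAr !scalerA -mulrA -expr2 sqrr_sign mulr1.
Qed.

End FubiniForms.

Section GaussImage.
Variables (C : numFieldType) (n d e : nat) (Q : mpoly n.+2 C).
Variables (U : set 'rV[C]_n.+2) (A : 'M[C]_n.+2) (D : set 'rV[C]_n).
Variable f : 'rV[C]_n -> C^o.
Hypothesis openU : open_in_hypersurface Q U.
Hypothesis framing : coordinate_framing Q A D f.

Lemma frame0_on_hypersurface z : D z -> on_hypersurface Q (frame0 A f z).
Proof. by move=> Dz; have [W _ /(_ z (f z))[_]] := framing_graph framing; case. Qed.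

(** Over [D] the point [e_0(z)] lies on the hypersurface, so membership in [U] is membership in an
    open set of the ambient space, and [e_0] is continuous. All the calculus takes place on this
    open set. *)
Lemma framing_domain_open : open [set z | D z /\ U (frame0 A f z)].
Proof.
have [[W oW ->] _] := openU; have oD := framing_open framing.
have dD : {in D, forall z, differentiable f z}.
  by move=> z; rewrite inE; exact: framing_holomorphic framing z.
rewrite openE => z [Dz [_ Wz]]; have Dz' : z \in D by rewrite inE.
have dx : differentiable (frame0 A f) z.
  apply: differentiable_rV => j.
  exact: (gen_diff oD dD (gen_frame_coord A D f j) Dz').
have nW : nbhs (frame0 A f z) W by exact: open_nbhs_nbhs.
have nD : nbhs z D by exact: open_nbhs_nbhs.
have := differentiable_continuous dx nW.
apply: filterS2 nD => y Dy Wy; split=> //; split=> //.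
exact: frame0_on_hypersurface.
Qed.

Hypothesis hypQ : hypersurface e Q.
Hypothesis smoothU : forall x, U x -> smooth_point Q x.
Hypothesis d_gt1 : (1 < d)%N.

Lemma fubini_gauss_image z : D z -> U (frame0 A f z) ->
  diff_rank (fubini_map d f) z = n ->
  Xi C n d (gauss_map (fubini_map d f) z) /\
  (e = d -> Phi C n d (gauss_map (fubini_map d f) z)).
Proof.
move=> Dz Uz rk; pose O := [set z | D z /\ U (frame0 A f z)].
have openO : open O := framing_domain_open.
have Oz : O z by [].
have diff_f : {in O, forall z, differentiable f z}.
  by move=> y; rewrite inE => -[Dy _]; exact: framing_holomorphic framing y Dy.
have Q0 : {in O, peval (frame_coord A f) Q =1 fun=> 0}.
  by move=> y; rewrite inE => -[/frame0_on_hypersurface[]].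
have smoothO : {in O, forall z, grad Q (frame0 A f z) != 0}.
  by move=> y; rewrite inE => -[_ /smoothU[]].
have [_ homQ _] := hypQ; have unitA := framing_unit framing.
have qN := dframe_max_neq0 openO diff_f Q0 homQ unitA smoothO.
have gen_f := gen_graph openO diff_f Q0 homQ unitA smoothO.
have comm_f := comm_graph openO diff_f Q0 homQ unitA smoothO.
have symP := fubini_map_sym openO diff_f gen_f comm_f d Oz.
have sym_a := @fubini_form_sym _ _ _ _ openO diff_f gen_f comm_f _ Oz d.+1.
have isE := fubini_map_is_E openO diff_f gen_f Oz (ltnW d_gt1).
split=> [|ed]; first by split=> //; exists (fubini_form f z d.+1).
split=> //; exists (fubini_form f z d.+1); split=> //; apply: fubini_in_ideal.
(* After one derivative the affine part of the coordinate is a constant, whose jets of positive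
   order vanish. *)
have jet_x j k : (1 < k)%N ->
    jet (frame_coord A f j) z k = A ord_max j *: jet f z k.
  case: k => // k k0; have gx := gen_frame_coord A O f j.
  rewrite (jetS openO diff_f gen_f comm_f _ gx Oz).
  rewrite (jetS openO diff_f gen_f comm_f _ (gen_base O f) Oz) scaler_sumr.
  apply: eq_bigr => a _; rewrite scalerAr; congr (_ * _).
  rewrite (eq_jet openO k Oz (partial_frame_coord A openO diff_f a j)).
  have gs := gen_scale (A ord_max j) (gen_f a).
  rewrite (jetD openO diff_f gen_f comm_f k (gen_cst O f _) gs Oz).
  rewrite (jet_cst openO diff_f gen_f comm_f _ Oz k0) add0r.
  exact: (jetZ openO diff_f gen_f comm_f _ _ (gen_f a) Oz).
have dQ : {in msupp Q, forall m, (mdeg m <= d)%N}.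
  by move=> m mQ; rewrite -ed (dhomog_mf homQ mQ).
have [_] := jet_peval_deg openO diff_f gen_f comm_f (gen_frame_coord A O f)
  Oz jet_x dQ (leqnn d).
(* The jet of [Q(e_0(z)) = 0] vanishes, so the ideal contains [- dframe ord_max z] times the jet of
   [f] of order [d + 1]; the sum with [mu j = A ord_max j] is [dframe ord_max z] by definition. Its
   inverse isolates the jet. *)
rewrite (eq_jet openO d.+1 Oz Q0).
rewrite (jet_cst openO diff_f gen_f comm_f 0 Oz (ltn0Sn d)) sub0r.
move=> /(jet_idealZ (- (dframe Q A f ord_max z)^-1)).
rewrite scaleNr scalerN opprK scalerA mulVf ?scale1r//.
by apply: qN; rewrite inE.
Qed.

End GaussImage.

Theorem theorem3p2 (R : realType) (n d e : nat)
  (Q : mpoly n.+2 R[i])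
  (Inv : set (mpoly n.+2 R[i] -> 'rV[R[i]]_n.+2 -> int))
  (U : set 'rV[R[i]]_n.+2)
  (A : 'M[R[i]]_n.+2) (D : set 'rV[R[i]]_n) (f : 'rV[R[i]]_n -> R[i]^o) :
  (2 <= d <= n)%N ->
  hypersurface e Q -> (d <= e)%N ->
  nondegenerate_gauss_map Q ->
  (forall I, Inv I -> discrete_projective_invariant d I) ->
  open_in_hypersurface Q U ->
  (forall x, U x -> general_point Inv Q x) ->
  coordinate_framing Q A D f ->
  (forall x, U x -> exists2 z, D z & exists2 c : R[i], c != 0 & x = c *: frame0 A f z) ->
  let UD := [set z | D z /\ U (frame0 A f z)] in
  (forall z, UD z -> diff_rank (fubini_map d f) z = n) ->
  gauss_map (fubini_map d f) @` UD `<=` Xi _ n d /\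
  (e = d -> gauss_map (fubini_map d f) @` UD `<=` Phi _ n d).
Proof.
move=> /andP[d_gt1 _] hypQ _ _ _ openU genU framing _ UD rk.
have smoothU x : U x -> smooth_point Q x by case/genU.
have main z (UDz : UD z) := fubini_gauss_image openU framing hypQ smoothU d_gt1
  (proj1 UDz) (proj2 UDz) (rk z UDz).
by split=> [PE|ed PE] [z UDz <-]; have [? H] := main z UDz => //; exact: H.
Qed.
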